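(* Let $F:\mathbb{C}[x_1,x_2]\to\mathbb{C}[x_1,x_2]$ be a $\mathbb{C}$-algebra endomorphism that has an invertible Jacobian; write $F_i=F(x_i)$, and let $d_i$ denote the degree of the minimal polynomial of $x_i$ over $\mathbb{C}(F_1,F_2)$, $i=1,2$. Assume that the coefficients of the minimal polynomial of $x_1$ over $\mathbb{C}[F_1,F_2]$ are either all symmetric or all skew-symmetric with respect to the exchange involution $\alpha$ given by $\alpha(x_1)=x_2$, $\alpha(x_2)=x_1$. If $\gcd(d_1,d_2)=1$ or $\gcd(d_1,d_2)=p$, where $p\ge 2$ is a prime number, then $F$ is an automorphism.
   Context: $F$ has an invertible Jacobian means $\operatorname{Jac}(F_1,F_2)=\det(\partial F_i/\partial x_j)\in\mathbb{C}^*$. The field $\mathbb{C}(F_1,F_2)$ is regarded as a subfield of $\mathbb{C}(x_1,x_2)$. Let $f_1$ be the (monic) minimal polynomial of $x_1$ over the field $\mathbb{C}(F_1,F_2)$. The minimal polynomial of $x_1$ over $\mathbb{C}[F_1,F_2]$ means $f_1$ multiplied by the least common multiple of the denominators of the coefficients of $f_1$ (this lcm exists since $\mathbb{C}[F_1,F_2]$ is a UFD; it is unique up to a nonzero constant). $\alpha$ is the $\mathbb{C}$-algebra automorphism of $\mathbb{C}[x_1,x_2]$ exchanging $x_1$ and $x_2$; an element $c\in\mathbb{C}[x_1,x_2]$ is symmetric with respect to $\alpha$ if $\alpha(c)=c$ and skew-symmetric if $\alpha(c)=-c$. *)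

(* Defs.v *)
From mathcomp Require Import all_boot all_order all_fingroup all_algebra.
From mathcomp Require Export complex.
From mathcomp Require Export reals.
From mathcomp Require Export mpoly.

Set Implicit Arguments.
Unset Strict Implicit.
Unset Printing Implicit Defensive.

Import GRing.Theory.
Local Open Scope ring_scope.

Notation "x %:F" := (@FracField.tofrac _ x) : ring_scope.

(* The complex numbers are R[i] for R : realType; the variables x_1 and x_2
   have indices 0 and 1 in 'I_2. *)
Definition x1 (C : idomainType) : {mpoly C[2]} := 'X_ord0.
Definition x2 (C : idomainType) : {mpoly C[2]} := 'X_ord_max.

Definition exchange (C : idomainType) (p : {mpoly C[2]}) : {mpoly C[2]} :=
  msym (tperm ord0 ord_max) p.

Definition jacobian (C : idomainType) (F1 F2 : {mpoly C[2]}) : {mpoly C[2]} :=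
  \det (\matrix_(i < 2, j < 2) mderiv j (tnth [tuple F1; F2] i)).

(* C[F1, F2], as a subset of C[x1, x2] *)
Definition alg_gen (C : idomainType) (F1 F2 : {mpoly C[2]}) :
    {mpoly C[2]} -> Prop :=
  fun p => exists q : {mpoly C[2]}, p = q \mPo [tuple F1; F2].

(* In the following definitions A is (the carrier of) a subring of D. *)

Definition frac_of (D : idomainType) (A : D -> Prop) : {fraction D} -> Prop :=
  fun z => exists a b : D, [/\ A a, A b, b != 0 & z = a%:F / b%:F].

Definition dvd_in (D : idomainType) (A : D -> Prop) (a b : D) : Prop :=
  exists2 c : D, A c & b = c * a.

Definition coprime_in (D : idomainType) (A : D -> Prop) (a b : D) : Prop :=
  forall d : D, A d -> dvd_in A d a -> dvd_in A d b -> dvd_in A d 1.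

(* b is a denominator of z written in lowest terms over A; when A is a UFD,
   it is unique up to a unit of A. *)
Definition is_denom (D : idomainType) (A : D -> Prop) (z : {fraction D})
    (b : D) : Prop :=
  [/\ A b, b != 0 &
      exists a : D, [/\ A a, coprime_in A a b & z = a%:F / b%:F]].

Definition is_denom_lcm (D : idomainType) (A : D -> Prop)
    (f : {poly {fraction D}}) (l : D) : Prop :=
  [/\ A l, l != 0,
      forall (i : nat) (b : D), is_denom A f`_i b -> dvd_in A b l &
      forall m : D, A m ->
        (forall (i : nat) (b : D), is_denom A f`_i b -> dvd_in A b m) ->
        dvd_in A l m].

(* The monic minimal polynomial of z over a subfield K of L *)
Definition is_minpoly (L : fieldType) (K : L -> Prop) (z : L)
    (f : {poly L}) : Prop :=
  [/\ f \is monic, forall i : nat, K f`_i, root f z &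
      forall g : {poly L}, g != 0 -> (forall i : nat, K g`_i) -> root g z ->
        (size f <= size g)%N].

(* g is the minimal polynomial f of z over Frac A multiplied by a least common
   multiple of the denominators of the coefficients of f; it is determined up
   to a unit of A. *)
Definition is_ring_minpoly (D : idomainType) (A : D -> Prop) (z : {fraction D})
    (g : {poly D}) : Prop :=
  (forall i : nat, A g`_i) /\
  exists (f : {poly {fraction D}}) (l : D),
    [/\ is_minpoly (frac_of A) z f, is_denom_lcm A f l &
        map_poly (@FracField.tofrac D) g = l%:F *: f].

Definition poly_degree (L : nzRingType) (f : {poly L}) : nat := (size f).-1.

(* Main.v *)
(** Write M = C[x1, x2], A = C[F1, F2] and K = Frac A.  Applying the exchange to
    g(x1) = 0 shows that x2 is a conjugate of x1 over K, so d1 = d2 and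
    gcd(d1, d2) = d1 is 1 or a prime.

    K is closed under m-th roots in Frac M.  Indeed, the Jacobian condition makes
    the image under F of a prime of C[x1, x2] squarefree in M, and images of
    coprime elements stay coprime: a common prime factor q of F a and F b would
    divide F1 - c and F2 - d for some constants c, d (eliminate a variable and
    factor the result over C), hence the Jacobian.  So if F a is an m-th power
    then all multiplicities of a are divisible by m.  The same argument gives
    K :&: M = A.

    If d1 = 1 then x1 and x2 lie in K :&: M = A.  If d1 is prime, then
    K(x1) contains x2: the derivations d/dF1 and d/dF2 preserve K(x1), and so
    does d/dx2 = (dF1/dx2) d/dF1 + (dF2/dx2) d/dF2 because dF1/dx2 and dF2/dx2 are,
    up to constants, d x1/dF2 and d x1/dF1; differentiating F1 or F2 until it has
    degree one in x2 yields x2.  Thus x1 |-> x2 extends to a nontrivial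
    automorphism of K(x1) / K with fixed field K, and a Lagrange resolvent is an
    element outside K one of whose powers is in K, a contradiction. *)

Require Import Defs.
From HB Require Import structures.
From mathcomp Require Import all_boot all_order all_fingroup all_algebra.
From mathcomp Require Import complex reals mpoly.
From mathcomp Require Import cyclic falgebra fieldext separable galois cyclotomic ring.

Import Order.TTheory GRing.Theory Num.Theory.
Local Open Scope ring_scope.
Local Open Scope complex_scope.

Set Implicit Arguments.
Unset Strict Implicit.
Unset Printing Implicit Defensive.

(** * Fractions and roots of unity *)

Lemma fraction_ratio (D : idomainType) (z : {fraction D}) :
  exists a b : D, b != 0 /\ z = a%:F / b%:F.
Proof.
elim/quotW: z => x; have d0 : x.2 != 0 by exact: denom_ratioP.
exists x.1, x.2; split=> //; unlock FracField.tofrac.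
rewrite -[X in _ * X]FracField.pi_inv -[RHS]FracField.pi_mul /FracField.mulf /FracField.invf.
rewrite !numden_Ratio ?numden_Ratio ?oner_neq0 //.
by rewrite mulr1 mul1r FracField.Ratio_numden.
Qed.

Section FracOf.
Variables (D : idomainType) (A : D -> Prop).
Hypotheses (A1 : A 1) (AB : forall a b, A a -> A b -> A (a - b))
  (AM : forall a b, A a -> A b -> A (a * b)).

Lemma frac_of_tofrac a : A a -> frac_of A a%:F.
Proof. by move=> Aa; exists a, 1; rewrite oner_neq0 rmorph1 divr1. Qed.

Lemma frac_ofB z w : frac_of A z -> frac_of A w -> frac_of A (z - w).
Proof.
case=> [a [b [Aa Ab b0 ->]]] [c [d [Ac Ad d0 ->]]].
exists (a * d - c * b), (b * d); split; rewrite ?mulf_neq0 //; auto.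
by rewrite -mulNr addf_div ?tofrac_eq0 // rmorphB !rmorphM /= mulNr.
Qed.

Lemma frac_of_div z w : frac_of A z -> frac_of A w -> frac_of A (z / w).
Proof.
case=> [a [b [Aa Ab b0 ->]]] [c [d [Ac Ad d0 ->]]].
have [c0|c0] := eqVneq c 0.
  have A0 : A 0 by rewrite -(subrr 1); apply: AB.
  by rewrite c0 rmorph0 mul0r invr0 mulr0; exists 0, 1; rewrite oner_neq0 rmorph0 mul0r.
exists (a * d), (b * c); split; rewrite ?mulf_neq0 //; auto.
by rewrite invf_div mulf_div !rmorphM.
Qed.

Lemma frac_ofD z w : frac_of A z -> frac_of A w -> frac_of A (z + w).
Proof.
move=> Kz Kw; rewrite -[w]opprK; apply: frac_ofB => //; rewrite -sub0r.
by apply: frac_ofB; rewrite // -(subrr 1); apply: frac_ofB; apply: (frac_of_tofrac A1).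
Qed.

Lemma frac_ofM z w : frac_of A z -> frac_of A w -> frac_of A (z * w).
Proof.
move=> Kz Kw; rewrite -[w]invrK; apply: frac_of_div => //; rewrite -div1r.
by apply: frac_of_div; rewrite -?(rmorph1 (@FracField.tofrac D)) //; apply: (frac_of_tofrac A1).
Qed.

End FracOf.

(** In characteristic zero ['X^m - 1] is separable, so it has [m] distinct roots, and these contain
    a primitive one. *)
Lemma closed_prim_root (C : numClosedFieldType) m : (0 < m)%N ->
  exists w : C, m.-primitive_root w.
Proof.
move=> m0; have [rs] := closed_field_poly_normal ('X^m - 1 : {poly C}).
rewrite (monicP _) ?monicXnsubC // scale1r => E.
have rsP : all m.-unity_root rs by apply/allP=> w; rewrite -root_prod_XsubC -E.
have uniq_rs : uniq rs.
  by rewrite -separable_prod_XsubC -E separable_Xn_sub_1 // pnatr_eq0 -lt0n.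
have size_rs : (m <= size rs)%N.
  by rewrite -ltnS -(size_prod_XsubC rs id) -E size_XnsubC.
by have /hasP[w _ wP] := has_prim_root m0 rsP uniq_rs size_rs; exists w.
Qed.

(** * Factoriality of C[X][Y] *)

Section Divisibility.
Variable D : idomainType.
Implicit Types a b q : D.

Definition divides a b := exists c, b = c * a.

Definition irreducible_elt q :=
  [/\ q != 0, q \isn't a GRing.unit &
      forall a b, q = a * b -> a \is a GRing.unit \/ b \is a GRing.unit].

Definition prime_elt q :=
  [/\ q != 0, q \isn't a GRing.unit &
      forall a b, divides q (a * b) -> divides q a \/ divides q b].

Lemma divides_refl a : divides a a.
Proof. by exists 1; rewrite mul1r. Qed.

Lemma divides_trans b a c : divides a b -> divides b c -> divides a c.
Proof. by case=> u -> [v ->]; exists (v * u); rewrite mulrA. Qed.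

Lemma divides_mull a b c : divides a b -> divides a (c * b).
Proof. by case=> u ->; exists (c * u); rewrite mulrA. Qed.

Lemma divides_mulr a b c : divides a b -> divides a (b * c).
Proof. by rewrite mulrC; apply: divides_mull. Qed.

Lemma dividesD a b c : divides a b -> divides a c -> divides a (b + c).
Proof. by case=> u -> [v ->]; exists (u + v); rewrite mulrDl. Qed.

Lemma dividesN a b : divides a b -> divides a (- b).
Proof. by case=> u ->; exists (- u); rewrite mulNr. Qed.

Lemma dividesB a b c : divides a b -> divides a c -> divides a (b - c).
Proof. by move=> ab ac; apply/dividesD/dividesN. Qed.

Lemma prime_ndiv_unit q u : prime_elt q -> u \is a GRing.unit -> ~ divides q u.
Proof.
case=> _ + _ => /negP qNu uU [c E]; apply: qNu.
by move: uU; rewrite E unitrM => /andP[].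
Qed.

Lemma prime_dividesX q a n : prime_elt q -> divides q (a ^+ n) -> divides q a.
Proof.
move=> qP; elim: n => [|n IHn]; first by move=> /(prime_ndiv_unit qP (unitr1 _)).
by case: qP => _ _ qM; rewrite exprS => /qM[|/IHn].
Qed.

Lemma prime_dividesZ q u a : prime_elt q -> u \is a GRing.unit ->
  divides q (u * a) -> divides q a.
Proof. by move=> qP uU; case: (qP) => _ _ qM /qM[/(prime_ndiv_unit qP uU)|]. Qed.

End Divisibility.

Lemma divides_rmorph (D E : idomainType) (f : {rmorphism D -> E}) a b :
  divides a b -> divides (f a) (f b).
Proof. by case=> c ->; exists (f c); rewrite rmorphM. Qed.

Section DivisibilityTransfer.
Variables (D E : idomainType) (f : {rmorphism D -> E}) (g : {rmorphism E -> D}).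
Hypotheses (fK : cancel f g) (gK : cancel g f).

Lemma divides_iso a b : divides (f a) (f b) -> divides a b.
Proof. by move/(divides_rmorph g); rewrite !fK. Qed.

Lemma unit_iso a : (f a \is a GRing.unit) = (a \is a GRing.unit).
Proof.
apply/idP/idP; last exact: rmorph_unit.
by move/(rmorph_unit g); rewrite fK.
Qed.

Lemma eq0_iso a : (f a == 0) = (a == 0).
Proof. by rewrite -(inj_eq (can_inj fK)) rmorph0. Qed.

Lemma irreducible_iso a : irreducible_elt a -> irreducible_elt (f a).
Proof.
case=> a0 aU aI; split; rewrite ?eq0_iso ?unit_iso // => u v fa.
rewrite -[u]gK -[v]gK !unit_iso; apply: aI.
by rewrite -rmorphM -fa fK.
Qed.

Lemma prime_iso a : prime_elt (f a) -> prime_elt a.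
Proof.
case=> + + aM; rewrite eq0_iso unit_iso => a0 aU; split=> // u v.
by move/(divides_rmorph f); rewrite rmorphM => /aM[]/divides_iso; [left|right].
Qed.

End DivisibilityTransfer.

(** * Gauss's lemma and elimination in two variables *)

Section BivariateFactoriality.
Variable C : closedFieldType.
Implicit Types (c : C) (r : {poly C}) (f g h m p a : {poly {poly C}}).

Let lin c : {poly {poly C}} := ('X - c%:P)%:P.

Lemma lin_dividesE c f :
  divides (lin c) f <-> map_poly (horner_eval c) f = 0.
Proof.
split=> [[u ->]|f0].
  by rewrite rmorphM /= map_polyC /= horner_evalE hornerXsubC subrr mulr0.
exists (map_poly (fun r => r %/ ('X - c%:P)) f); apply/polyP=> i.
rewrite coefMC coef_map_id0 ?div0p //.
move/polyP/(_ i): f0; rewrite coef0 coef_map /= horner_evalE => fi0.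
by rewrite divpK // dvdp_XsubCl; apply/rootP.
Qed.

(** [lin c] generates the kernel of the specialization of the inner variable at [c], whose target
    [{poly C}] is a domain. *)
Lemma lin_prime c : prime_elt (lin c).
Proof.
split; first by rewrite polyC_eq0 polyXsubC_eq0.
  by rewrite poly_unitE coefC eqxx poly_unitE size_XsubC andbF.
move=> f g /lin_dividesE/eqP; rewrite rmorphM mulf_eq0.
by case/orP=> /eqP ?; [left|right]; apply/lin_dividesE.
Qed.

(** A form of Gauss's lemma: [r] is a product of linear factors, and each prime [lin c] divides [h]
    or [m] and is moved into [r1] or [r2] accordingly. *)
Lemma const_split r (r0 : r != 0) f h m : r%:P * f = h * m ->
  exists r1 r2 h' m', [/\ r1 != 0, r2 != 0, h = r1%:P * h', m = r2%:P * m'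
    & f = h' * m'].
Proof.
have [n] := ubnP (size r); elim: n => // n IHn in r r0 h m * => size_r E.
have [/eqP/size_poly1P[c c0 Dr]|/closed_rootP[c /factor_theorem[s Ds]]] := eqVneq (size r) 1%N.
  exists 1, r, h, (c^-1%:P%:P * m); rewrite oner_neq0 r0 !mul1r Dr; split=> //.
    by rewrite mulrA -!rmorphM /= divff // !rmorph1 mul1r.
  by rewrite mulrCA -E Dr mulrA -!rmorphM /= mulVf // !rmorph1 mul1r.
have s0 : s != 0 by apply: contraNneq r0 => s0; rewrite Ds s0 mul0r.
have l0 : lin c != 0 by case: (lin_prime c).
have size_s : (size s < n)%N by rewrite Ds size_Mmonic ?monicXsubC // size_XsubC addn2 in size_r.
have EE : s%:P * f * lin c = h * m.
  by rewrite -E Ds rmorphM /= -!mulrA; congr (_ * _); rewrite mulrC.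
have [[h1 Dh]|[m1 Dm]] : divides (lin c) h \/ divides (lin c) m.
- by case: (lin_prime c) => _ _; apply; exists (s%:P * f).
- have /(IHn _ s0 _ _ size_s) : s%:P * f = h1 * m.
    by apply: (mulIf l0); rewrite EE Dh mulrAC.
  case=> r1 [r2 [h' [m' [r10 r20 Dh1 Dm Df]]]].
  exists (('X - c%:P) * r1), r2, h', m'; split=> //.
    by rewrite mulf_neq0 // polyXsubC_eq0.
  by rewrite Dh Dh1 rmorphM /= -/(lin c) mulrC mulrA.
- have /(IHn _ s0 _ _ size_s) : s%:P * f = h * m1.
    by apply: (mulIf l0); rewrite EE Dm mulrA.
  case=> r1 [r2 [h' [m' [r10 r20 Dh Dm1 Df]]]].
  exists r1, (('X - c%:P) * r2), h', m'; split=> //.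
    by rewrite mulf_neq0 // polyXsubC_eq0.
  by rewrite Dm Dm1 rmorphM /= -/(lin c) mulrC mulrA.
Qed.

(** [const_split] writes [p] as [r2%:P * p'] with [p'] dividing [f]; irreducibility makes one of the
    two factors a unit, which gives the two alternatives. *)
Lemma prime_const_cancel r p f : r != 0 -> irreducible_elt p ->
  divides p (r%:P * f) -> (exists2 r', r' != 0 & divides p r'%:P) \/ divides p f.
Proof.
move=> r0 [p0 pU pI] [u /(const_split r0)].
case=> r1 [r2 [u' [p' [r10 r20 _ Dp Df]]]].
have [[r2U]|p'U] := pI _ _ Dp.
  by right; exists (u' / r2%:P); rewrite Dp Df mulrA divrK.
left; exists r2 => //; exists (p'^-1); rewrite Dp mulrCA mulVr ?mulr1 //.
Qed.

(** Unless [p] or [a] is already free of the outer variable, [r] is their resultant. A zero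
    resultant would give a common factor of positive degree and force [p] to divide [a]. *)
Lemma irreducible_elimination p a : irreducible_elt p -> ~ divides p a ->
  exists2 r, r != 0 & exists u v, r%:P = u * p + v * a.
Proof.
move=> pI pNa; have [p0 pU pE] := pI.
have a0 : a != 0 by apply/eqP=> a0; apply: pNa; exists 0; rewrite a0 mul0r.
have [] := leqP (size p) 1.
  move=> /size1_polyC Dp; exists p`_0; first by rewrite -polyC_eq0 -Dp.
  by exists 1, 0; rewrite -Dp mul1r mul0r addr0.
have [] := leqP (size a) 1.
  move=> /size1_polyC Da _; exists a`_0; first by rewrite -polyC_eq0 -Da.
  by exists 0, 1; rewrite -Da mul1r mul0r add0r.
move=> sa sp; have [res0|res] := eqVneq (resultant p a) 0; last first.
  by have [[u v] _ E] := resultant_in_ideal sp sa; exists (resultant p a) => //; exists u, v.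
case: pNa; move/eqP: res0; rewrite resultant_eq0; set d := gcdp p a => sd.
(* Over the ring [{poly C}] division by the gcd leaves multipliers [r] and [s]; [const_split]
   removes [r] and [prime_const_cancel] removes [s]. *)
have /Pdiv.Idomain.dvdpP[[r u] /= r0 Ep] : d %| p by exact: dvdp_gcdl.
have /Pdiv.Idomain.dvdpP[[s v] /= s0 Ea] : d %| a by exact: dvdp_gcdr.
rewrite -mul_polyC in Ep; rewrite -mul_polyC in Ea.
have [r1 [r2 [u' [d' [r10 r20 Du Dd Dp]]]]] := const_split r0 Ep.
have sd' : (1 < size d')%N by rewrite Dd mul_polyC size_scale in sd.
have u'U : u' \is a GRing.unit.
  have [//|] := pE _ _ Dp.
  by rewrite poly_unitE => /andP[/eqP E]; rewrite E in sd'.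
have dp : divides p d' by exists u'^-1; rewrite Dp mulrA mulVr // mul1r.
have : divides p (s%:P * a).
  by rewrite Ea Dd; do 2 apply: divides_mull.
case/(prime_const_cancel s0 pI) => // -[r' r'0 [w]] E.
have w0 : w != 0 by apply: contraNneq r'0 => w0; rewrite -polyC_eq0 E w0 mul0r.
have := size_mul w0 p0; rewrite -E size_polyC r'0 /=.
move: w0 sp; rewrite -size_poly_gt0.
by case: (size w) => // k _; case: (size p) => [|[|j]] //= _; rewrite !addnS.
Qed.

(** If [p] divides [a * b] but not [a], elimination makes it divide [r%:P * b]. Cancelling [r]
    leaves [b], unless [p] divides a polynomial in the inner variable alone; then [p] is associated
    to some [lin c], which is prime. *)
Lemma irreducible_prime p : irreducible_elt p -> prime_elt p.
Proof.
move=> pI; have [p0 pU pE] := pI; split=> // a b pab.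
have [pa|pNa] := boolp.pselect (divides p a); first by left.
have [r r0 [u [v E]]] := irreducible_elimination pI pNa.
have : divides p (r%:P * b).
  rewrite E mulrDl; apply: dividesD; first by exists (u * b); rewrite mulrAC.
  by rewrite -mulrA; apply: divides_mull.
case/(prime_const_cancel r0 pI) => [[s s0 ps]|]; last by right.
(* Splitting [s%:P * 1 = w * p] makes [p'] a divisor of [1]; since [p] is not a unit, [r2] is not
   constant and has a root. *)
case: ps => w; rewrite -[LHS]mulr1 => /(const_split s0).
case=> r1 [r2 [w' [p' [_ r20 _ Dp E1]]]].
have p'U : p' \is a GRing.unit by apply/unitrPr; exists w'; rewrite mulrC.
have [c /factor_theorem[t Dt]] : exists c, root r2 c.
  apply/closed_rootP/negP=> /size_poly1P[c c0 Dr2].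
  by case/negP: pU; rewrite Dp Dr2 unitrM p'U andbT !rmorph_unit // unitfE.
have Dpx : p = (t%:P * p') * lin c by rewrite Dp Dt rmorphM /= mulrAC.
have [xU|lU] := pE _ _ Dpx; last by case: (lin_prime c); rewrite lU.
have pl : divides p (lin c).
  by exists (t%:P * p')^-1; rewrite Dpx mulKr.
have [_ _ lM] := lin_prime c.
have : divides (lin c) (a * b) by apply: divides_trans pab; exists (t%:P * p').
by case/lM=> /(divides_trans pl); [left|right].
Qed.

End BivariateFactoriality.

(** * Multivariate polynomials *)

Section MpolyGenerators.
Variables (n : nat) (C : nzRingType).

Lemma mpoly_ring_ind (P : {mpoly C[n]} -> Prop) :
  (forall c, P c%:MP) -> (forall i, P 'X_i) ->
  (forall p q, P p -> P q -> P (p + q)) ->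
  (forall p q, P p -> P q -> P (p * q)) -> forall p, P p.
Proof.
move=> PC PX PD PM; have P1 : P 1 by rewrite -mpolyC1.
have PXm i k : P ('X_i ^+ k) by elim: k => [|k IHk]; [rewrite expr0 | rewrite exprS; apply: PM].
elim/mpolyind=> [|c m p _ _ Pp]; first by rewrite -mpolyC0.
apply: PD => //; rewrite -mul_mpolyC; apply: (PM) => //.
by rewrite mpolyXE_id; apply: (big_ind P).
Qed.

End MpolyGenerators.

Lemma mpoly_rmorph_ext n (C D : nzRingType) (f g : {rmorphism {mpoly C[n]} -> D}) :
  (forall c, f c%:MP = g c%:MP) -> (forall i, f 'X_i = g 'X_i) -> f =1 g.
Proof.
move=> fgC fgX; elim/mpoly_ring_ind => // p q fp fq.
  by rewrite !rmorphD fp fq.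
by rewrite !rmorphM fp fq.
Qed.

Lemma ord2E (i : 'I_2) : i = ord0 \/ i = ord_max.
Proof. by case: i => [[|[|]]] // i; [left|right]; apply: val_inj. Qed.

Section MpolyDegree.
Variables (n : nat) (C : idomainType).
Implicit Types p q : {mpoly C[n]}.

Lemma mpoly_unitP p : reflect (exists2 c, c \is a GRing.unit & p = c%:MP) (p \is a GRing.unit).
Proof.
apply: (iffP andP) => [[/eqP pE pU]|[c cU ->]]; first by exists p@_0.
by rewrite mcoeffC eqxx mulr1.
Qed.

Lemma msize_deriv i p : p != 0 -> (msize p^`M(i) < msize p)%N.
Proof.
move=> p0; have [d0|d0] := eqVneq p^`M(i) 0.
  by rewrite d0 msize0 lt0n msize_poly_eq0.
rewrite -(mlead_deg d0); have := mlead_supp d0.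
rewrite mcoeff_msupp mcoeff_mderiv; set m := mlead _ => H.
have : (m + U_(i))%MM \in msupp p.
  by rewrite mcoeff_msupp; apply: contraNneq H => ->; rewrite mul0rn.
by move/msize_mdeg_lt; rewrite mdegD mdeg1 addn1.
Qed.

End MpolyDegree.

(** If [m i > 0], the coefficient of [p] at [m] appears in the [i]-th derivative multiplied by
    [m i], which is nonzero in characteristic zero. *)
Lemma mderiv0_const n (C : numDomainType) (p : {mpoly C[n]}) :
  (forall i, p^`M(i) = 0) -> p = (p@_0)%:MP.
Proof.
move=> dp0; apply/mpolyP=> m; rewrite mcoeffC.
have [->|m0] := eqVneq m 0%MM; first by rewrite mulr1.
rewrite mulr0.
have [i mi] : exists i, (0 < m i)%N.
  apply/existsP; apply: contraNT m0 => /existsPn H; apply/eqP/mnmP=> i.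
  by rewrite mnm0E; apply/eqP; rewrite -leqn0 leqNgt H.
have := mcoeff_mderiv i p (m - U_(i))%MM.
rewrite dp0 mcoeff0 submK ?lep1mP // => [/esym/eqP|]; last by rewrite -lt0n.
by rewrite -mulr_natr mulf_eq0 pnatr_eq0 // orbF => /eqP.
Qed.

Lemma mderiv_var (n : nat) (C : nzRingType) (i j : 'I_n) :
  mderiv i ('X_j : {mpoly C[n]}) = (i == j)%:R.
Proof.
rewrite mderivX mnm1E eq_sym; case: eqP => [->|_]; last by rewrite scale0r.
have -> : (U_(j) - U_(j) = 0 :> 'X_{1..n})%MM by apply/mnmP=> k; rewrite mnmBE mnm0E subnn.
by rewrite scale1r mpolyX0.
Qed.

(** * Primes of [C[x1, x2]] and specialization of [x1] *)

Section BivariatePrimes.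
Variable C : numClosedFieldType.
Local Notation M := {mpoly C[2]}.
Implicit Types (p q a b : M) (r : {poly C}).

Definition peval (u : M) : {poly C} -> M :=
  horner_morph (fun c : C => mulrC u c%:MP).
HB.instance Definition _ u := GRing.RMorphism.on (peval u).

Lemma pevalE u r : peval u r = (map_poly (@mpolyC 2 C) r).[u].
Proof. by []. Qed.

Lemma pevalX u : peval u 'X = u. Proof. exact: horner_morphX. Qed.

Lemma pevalC u c : peval u c%:P = c%:MP. Proof. exact: horner_morphC. Qed.

(** The outer variable becomes [x2] and the inner one [x1], so elimination of the outer variable
    yields polynomials in [x1]. *)
Definition of_biv : {poly {poly C}} -> M :=
  horner_morph (fun r => mulrC (x2 C) (peval (x1 C) r)).
HB.instance Definition _ := GRing.RMorphism.on of_biv.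

Lemma of_bivX : of_biv 'X = x2 C. Proof. exact: horner_morphX. Qed.

Lemma of_bivC r : of_biv r%:P = peval (x1 C) r. Proof. exact: horner_morphC. Qed.

Definition to_biv : M -> {poly {poly C}} :=
  mmap (polyC \o polyC) (fun i => if i == ord0 then 'X%:P else 'X).
HB.instance Definition _ := GRing.RMorphism.on to_biv.

Lemma to_bivK : cancel to_biv of_biv.
Proof.
apply: (mpoly_rmorph_ext (f := of_biv \o to_biv) (g := idfun)) => [c|i] /=.
  by rewrite /to_biv mmapC /= of_bivC pevalC.
rewrite /to_biv mmapX mmap1U; case: (ord2E i) => -> /=.
  by rewrite of_bivC pevalX.
by rewrite of_bivX.
Qed.

Lemma of_bivK : cancel of_biv to_biv.
Proof.
have to_peval r : to_biv (peval (x1 C) r) = r%:P.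
  elim/poly_ind: r => [|r c IHr]; first by rewrite !rmorph0.
  rewrite !rmorphD !rmorphM /= IHr pevalX pevalC /to_biv mmapC /=.
  by rewrite /x1 mmapX mmap1U eqxx.
elim/poly_ind=> [|f r IHf]; first by rewrite !rmorph0.
rewrite !rmorphD !rmorphM /= IHf of_bivX of_bivC to_peval.
by rewrite /to_biv mmapX mmap1U.
Qed.

Lemma mpoly_irreducible_prime p : irreducible_elt p -> prime_elt p.
Proof.
move=> pI; apply: (prime_iso to_bivK); apply: irreducible_prime.
exact: (irreducible_iso to_bivK of_bivK).
Qed.

Lemma prime_irreducible p : prime_elt p -> irreducible_elt p.
Proof.
case=> p0 pU pM; split=> // a b pE.
have [[c aE]|[c bE]] : divides p a \/ divides p b.
- by apply: pM; rewrite -pE; apply: divides_refl.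
- right; apply/unitrPr; exists c; apply: (mulIf p0).
  by rewrite mul1r -mulrA -aE mulrC -pE.
- left; apply/unitrPr; exists c; apply: (mulIf p0).
  by rewrite mul1r -mulrA -bE -pE.
Qed.

Lemma msize_nonunit p : p != 0 -> p \isn't a GRing.unit -> (1 < msize p)%N.
Proof.
move=> p0; apply: contraR; rewrite -leqNgt => /msize1_polyC pE.
apply/mpoly_unitP; exists p@_0 => //; rewrite unitfE.
by apply: contraNneq p0 => E; rewrite pE E mpolyC0.
Qed.

Lemma msize_factor p q a : a != 0 -> p \isn't a GRing.unit -> a = p * q ->
  (msize q < msize a)%N.
Proof.
move=> a0 pU aE; move: (a0); rewrite aE mulf_eq0 negb_or => /andP[p0 q0].
have := msize_nonunit p0 pU; rewrite msizeM //.
by case: (msize p) => [|[|k]] // _; rewrite !addSn /= ltnS leq_addl.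
Qed.

Lemma prime_divisor a : a != 0 -> a \isn't a GRing.unit ->
  exists2 p, prime_elt p & divides p a.
Proof.
have [n] := ubnP (msize a); elim: n => // n IHn in a * => sa a0 aU.
have [aI|aNI] := boolp.pselect (irreducible_elt a).
  by exists a; [apply: mpoly_irreducible_prime | apply: divides_refl].
have [[u [v [aE uU vU]]]|H] := boolp.pselect (exists u v,
    [/\ a = u * v, u \isn't a GRing.unit & v \isn't a GRing.unit]).
  have [v0 sv] : v != 0 /\ (msize v < n)%N.
    split; first by apply: contraNneq a0 => v0; rewrite aE v0 mulr0.
    by apply: leq_trans (msize_factor a0 uU aE) _; rewrite -ltnS.
  have [p pP pv] := IHn _ sv v0 vU; exists p => //.
  by rewrite aE; apply: divides_mull.
case: aNI; split=> // u v aE.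
have [|uU] := boolP (u \is a GRing.unit); first by left.
have [|vU] := boolP (v \is a GRing.unit); first by right.
by case: H; exists u, v.
Qed.

Lemma prime_factorization q a : q \isn't a GRing.unit -> a != 0 ->
  exists e b, a = q ^+ e * b /\ ~ divides q b.
Proof.
move=> qU; have [n] := ubnP (msize a); elim: n => // n IHn in a * => sa a0.
have [[b ab]|qNa] := boolp.pselect (divides q a); last first.
  by exists 0%N, a; rewrite mul1r.
have [||e [c [bc qNc]]] := IHn b.
- apply: leq_trans (msize_factor (p := q) (q := b) a0 qU _) sa.
  by rewrite ab mulrC.
- by apply: contraNneq a0 => b0; rewrite ab b0 mul0r.
by exists e.+1, c; rewrite ab bc exprSr mulrAC.
Qed.

Lemma multiplicity_unique q a b k l : prime_elt q -> ~ divides q a ->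
  ~ divides q b -> q ^+ k * a = q ^+ l * b -> k = l.
Proof.
case=> q0 _ _ qNa qNb.
elim: k l => [|k IHk] [|l] //; rewrite ?expr0 ?mul1r ?exprSr => E.
- by case: qNa; exists (q ^+ l * b); rewrite E mulrAC.
- by case: qNb; exists (q ^+ k * a); rewrite -E mulrAC.
- by congr S; apply/IHk/(mulIf q0); rewrite !(mulrAC _ _ q).
Qed.

Lemma mpoly_elimination p a : prime_elt p -> ~ divides p a ->
  exists2 r, r != 0 & exists u v, peval (x1 C) r = u * p + v * a.
Proof.
move=> /prime_irreducible/(irreducible_iso to_bivK of_bivK) pI pNa.
have [|r r0 [u [v E]]] := irreducible_elimination (a := to_biv a) pI.
  by move/(divides_iso to_bivK).
exists r => //; exists (of_biv u), (of_biv v).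
by rewrite -of_bivC E rmorphD !rmorphM /= !to_bivK.
Qed.

(** [r] splits into linear factors over the closed field, so the prime [q] divides one of the
    factors [u - c%:MP]. *)
Lemma prime_divides_peval q u r : prime_elt q -> r != 0 ->
  divides q (peval u r) -> exists c, divides q (u - c%:MP).
Proof.
move=> qP; have [n] := ubnP (size r); elim: n => // n IHn in r *.
have [/eqP/size_poly1P[c c0 ->] _ _|] := eqVneq (size r) 1%N.
  rewrite pevalC => /prime_ndiv_unit[] //.
  by apply/mpoly_unitP; exists c; rewrite ?unitfE.
case/closed_rootP=> c /factor_theorem[s ->] sr.
rewrite mulf_eq0 negb_or => /andP[s0 _].
rewrite rmorphM; case: (qP) => _ _ qM /qM[|]; last first.
  by rewrite rmorphB /= pevalX pevalC; exists c.
by apply: IHn => //; rewrite size_Mmonic ?monicXsubC // size_XsubC addn2 in sr.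
Qed.

Definition specialize_x1 (c : C) : M -> {poly C} :=
  mmap polyC (fun i => if i == ord0 then c%:P else 'X).
HB.instance Definition _ c := GRing.RMorphism.on (specialize_x1 c).

Lemma specialize_x1_congr c p :
  divides (x1 C - c%:MP) (p - peval (x2 C) (specialize_x1 c p)).
Proof.
elim/mpoly_ring_ind: p => [d|i|p q IHp IHq|p q IHp IHq].
- by rewrite /specialize_x1 mmapC pevalC subrr; exists 0; rewrite mul0r.
- rewrite /specialize_x1 mmapX mmap1U; case: (ord2E i) => -> /=.
    by rewrite pevalC; apply: divides_refl.
  by rewrite pevalX subrr; exists 0; rewrite mul0r.
- by rewrite !rmorphD /= opprD addrACA; apply: dividesD.
- rewrite !rmorphM /=; set p' := peval _ _; set q' := peval _ _.
  have -> : p * q - p' * q' = p * (q - q') + q' * (p - p') by ring.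
  by apply: dividesD; apply: divides_mull.
Qed.

End BivariatePrimes.

Lemma to_biv_deriv (C : numClosedFieldType) (p : {mpoly C[2]}) :
  to_biv (mderiv ord_max p) = (to_biv p)^`().
Proof.
elim/mpoly_ring_ind: p => [c|j|p q IHp IHq|p q IHp IHq].
- by rewrite mderivC rmorph0 /to_biv mmapC derivC.
- rewrite mderiv_var /to_biv mmapX mmap1U; case: (ord2E j) => -> /=.
    by rewrite mmap0 derivC.
  by rewrite rmorph1 derivX.
- by rewrite mderivD !rmorphD /= derivD IHp IHq.
- by rewrite mderivM !(rmorphD, rmorphM) /= derivM IHp IHq.
Qed.

(** Under [to_biv] this is the formal derivative, whose coefficients are nonzero integer multiples
    of the coefficients of positive index. *)
Lemma mderiv2_eq0 (C : numClosedFieldType) (p : {mpoly C[2]}) :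
  mderiv ord_max p = 0 -> exists r, p = peval (x1 C) r.
Proof.
move=> dp0; exists (to_biv p)`_0; rewrite -of_bivC -[LHS]to_bivK; congr of_biv.
apply: size1_polyC; apply/leq_sizeP=> -[//|i] _.
have := congr1 (fun f : {poly {poly C}} => f`_i) (to_biv_deriv p).
rewrite dp0 rmorph0 coef0 coef_deriv => /polyP E; apply/polyP=> j.
by move/eqP: (E j); rewrite coefMn !coef0 eq_sym mulrn_eq0 => /eqP.
Qed.

(** * Kummer generators from a conjugate root *)

(** For nonzero [i] this is a geometric sum of ratio [w ^+ i != 1], and [(w ^+ i) ^+ m = 1]. *)
Lemma primitive_root_sum (K : fieldType) m (w : K) (i : 'I_m) :
  m.-primitive_root w -> \sum_(j < m) w ^+ (i * j) = (m * (nat_of_ord i == 0))%:R.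
Proof.
move=> wP; have [->|i0] := eqVneq (i : nat) 0%N.
  rewrite (eq_bigr (fun _ => 1)) => [|j _]; first by rewrite sumr_const card_ord muln1.
  by rewrite mul0n expr0.
rewrite muln0 (eq_bigr (fun j : 'I_m => (w ^+ i) ^+ j)) => [|j _]; last by rewrite exprM.
have /eqP : (w ^+ i - 1) * \sum_(j < m) (w ^+ i) ^+ j = 0.
  by rewrite -subrX1 exprAC (prim_expr_order wP) expr1n subrr.
rewrite mulf_eq0 subr_eq0 -(prim_order_dvd wP) => /orP[|/eqP //].
by rewrite gtnNdvd // lt0n.
Qed.

(** The resolvents satisfy [w ^+ j *: s (y j) = y j], so their [m]-th powers are fixed by [s], and
    prime dimension makes the fixed field the base field. They sum to [m%:R *: x], which is outside
    the base field, so some resolvent is too. *)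
Lemma lagrange_resolvent (K : fieldType) (E : fieldExtType K) (s : 'AEnd(E))
    (x : E) (m : nat) (w : K) :
  prime (\dim {:E}) -> s x != x -> iter m s x = x -> m.-primitive_root w ->
  exists2 y : E, y \notin 1%VS & y ^+ m \in 1%VS.
Proof.
move=> dimP sx sm wP; have wm := prim_expr_order wP.
have m0 := prim_root_natf_neq0 wP.
have fixE : fixedSpace s = 1%VS.
  have [_ dP] := primeP dimP.
  have /dP/orP[] := field_dimS (subvf (fixedSpace_aspace s)) => [|dE].
    by move/eqP=> d1; apply/esym/eqP; rewrite eqEdim sub1v dimv1 /= d1.
  have : fixedSpace s = fullv by apply/eqP; rewrite eqEdim subvf /= (eqP dE).
  by move=> fE; case/eqP: sx; apply/fixedSpaceP; rewrite fE memvf.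
pose f j i := w ^+ (i * j) *: iter i s x.
pose y j := \sum_(i < m) f j i.
have sy j : w ^+ j *: s (y j) = y j.
  transitivity (\sum_(i < m) f j i.+1).
    rewrite linear_sum scaler_sumr; apply: eq_bigr => i _.
    by rewrite linearZ /= scalerA -exprD -mulSn.
  have : f j m = f j 0 by rewrite /f exprM wm expr1n sm mul0n expr0.
  rewrite /y; case: (m) => [|k] fk; first by rewrite !big_ord0.
  by rewrite big_ord_recr big_ord_recl addrC /= fk.
have ym j : y j ^+ m \in 1%VS.
  rewrite -fixE; apply/fixedSpaceP; rewrite rmorphXn /=.
  by rewrite -[in RHS](sy j) exprZn -exprM mulnC exprM wm expr1n scale1r.
have [[j yj]|yF] := boolp.pselect (exists j, y j \notin 1%VS); first by exists (y j).
have sum_y : \sum_(j < m) y j = m%:R *: x.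
  rewrite exchange_big /=; have m_gt0 := prim_order_gt0 wP.
  rewrite (bigD1 (Ordinal m_gt0)) //= [X in _ + X]big1 => [|i i0].
    by rewrite addr0 -scaler_suml (primitive_root_sum (Ordinal m_gt0) wP) muln1.
  move: i0; rewrite -val_eqE /= -scaler_suml primitive_root_sum // => /negPf->.
  by rewrite muln0 scale0r.
case/eqP: sx; apply/fixedSpaceP; rewrite fixE.
suff : m%:R *: x \in 1%VS by move/(memvZ m%:R^-1); rewrite scalerA mulVf // scale1r.
rewrite -sum_y; apply: memv_suml => j _.
by apply/negPn/negP=> yj; apply: yF; exists j.
Qed.

Lemma irreducible_dvdp_root (K L : fieldType) (iota : {rmorphism K -> L}) (z : L)
    (p f : {poly K}) :
  irreducible_poly p -> root (map_poly iota p) z -> root (map_poly iota f) z -> p %| f.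
Proof.
move=> pI pz fz; rewrite -[_ %| _]negbK -irreducible_poly_coprime //; apply/negP.
by rewrite -(coprimep_map iota) => /coprimep_root/(_ pz); rewrite (rootP fz) eqxx.
Qed.

(* A root of [p] lying in the field generated by another root gives an
   automorphism of prime order, hence a Kummer generator. *)
Lemma conjugate_radical (K L : fieldType) (iota : {rmorphism K -> L}) (z z' : L)
    (p q : {poly K}) :
  irreducible_poly p -> prime (size p).-1 ->
  root (map_poly iota p) z -> root (map_poly iota p) z' -> z' != z ->
  z' = (map_poly iota q).[z] ->
  (forall m, (0 < m)%N -> exists w : K, m.-primitive_root w) ->
  exists w m, [/\ (0 < m)%N, exists a, w ^+ m = iota a & forall a, w <> iota a].
Proof.
move=> pI pP pz pz' z'z z'E primK.
have p0 : p != 0 by apply: irredp_neq0.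
(* [E] is [K[X] / p], embedded in [L] by [e], which sends the class [r] of ['X] to [z] and [y] to
   [z']. *)
pose E : fieldExtType K := SubFieldExtType pz pI.
pose r : E := subfx_root iota z p.
pose y : E := subfx_eval iota z p q.
pose e : {rmorphism E -> L} := subfx_inj.
have er : e r = z by exact: subfx_inj_root.
have ey : e y = z' by rewrite z'E; apply: subfx_inj_eval.
have eA a : e a%:A = iota a by exact: subfx_inj_base.
have eP (f : {poly K}) (t : E) : e (map_poly (in_alg E) f).[t] = (map_poly iota f).[e t].
  by rewrite -horner_map -map_poly_comp; congr _.[_]; apply: eq_map_poly.
have Egen (t : E) : exists f, t = (map_poly (in_alg E) f).[r].
  by have [f ->] := subfxEroot pz p0 t; exists f.
(* A polynomial over [K] that vanishes at [r] is a multiple of [p], hence vanishes at [y]; so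
   [r |-> y] extends to an endomorphism of [E]. *)
have ry : root (map_poly \1%VF (minPoly 1 r)) y.
  have -> : map_poly \1%VF (minPoly 1 r) = minPoly 1 r.
    by apply: map_poly_id => ? _; rewrite lfunE.
  have /polyOver1P[f fE] := minPolyOver 1 r.
  have fz : root (map_poly iota f) z.
    by apply/rootP; rewrite -er -eP -fE minPolyxx rmorph0.
  have /dvdpP[h hE] := irreducible_dvdp_root pI pz fz.
  apply/rootP/(fmorph_inj e); rewrite fE eP ey rmorph0 hE rmorphM hornerM /=.
  by rewrite (rootP pz') mulr0.
have homs := kHomExtendP (subvv _) (kHom1 1 1) ry.
set s := kHomExtend _ _ _ _ in homs.
have sr : s r = y by apply: kHomExtend_val ry; apply: (kHom1 1 1).
have full : <<1; r>>%VS = fullv.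
  apply/eqP; rewrite eqEsubv subvf; apply/subvP=> t _.
  have [f ->] := Egen t; apply: mempx_Fadjoin; apply/polyOver1P; by exists f.
have sA : ahom_in {:E} s by rewrite -full -k1HomE.
pose sig : 'AEnd(E) := AHom sA.
have dimE : \dim {:E} = (size p).-1 by rewrite dimvf.
have iter_root i : root (map_poly (in_alg E) p) (iter i sig r).
  elim: i => [|i IHi] /=.
    by apply/rootP/(fmorph_inj e); rewrite eP er rmorph0; apply/rootP.
  rewrite -[map_poly _ p](_ : map_poly sig (map_poly (in_alg E) p) = _).
    by rewrite rootE horner_map (rootP IHi) rmorph0.
  by rewrite -map_poly_comp; apply: eq_map_poly => a /=; rewrite linearZ /= (ahom_inP sA).2.
(* The iterates of [r] are roots of [p], so one of them repeats; injectivity of [sig] turns the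
   repetition into a return to [r]. *)
have [m m0 sm] : exists2 m, (0 < m)%N & iter m sig r = r.
  have : looping sig r (size p).
    apply: contraT; rewrite -looping_uniq => uT.
    have rT : all (root (map_poly (in_alg E) p)) (traject sig r (size p).+1).
      by apply/allP=> _ /trajectP[i _ ->]; apply: iter_root.
    have := max_poly_roots _ rT uT.
    by rewrite map_poly_eq0 p0 size_map_poly size_traject ltnNge leqnSn => /(_ isT).
  case/trajectP=> i ip sE; exists (size p - i)%N; first by rewrite subn_gt0.
  have inj : injective (iter i sig) by elim: (i) => //= k IHk ? ? /(fmorph_inj sig)/IHk.
  by apply: inj; rewrite -iterD subnKC 1?ltnW.
have [w wP] := primK m m0.
have [||t tN tm] := @lagrange_resolvent K E sig r m w _ _ sm wP.
- by rewrite dimE.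
- by rewrite /= sr; apply: contraNneq z'z => yr; rewrite -ey -er yr.
exists (e t), m; split=> //.
  by case/vlineP: tm => a tE; exists a; rewrite -rmorphXn /= tE eA.
move=> a; rewrite -eA => /(fmorph_inj e) tE; case/negP: tN.
by apply/vlineP; exists a.
Qed.

(** * Minimal polynomials over a subfield *)

Section SubfieldType.
Variables (L : fieldType) (P : L -> Prop).
Hypotheses (P1 : P 1) (PB : forall x y, P x -> P y -> P (x - y))
  (Pdiv : forall x y, P x -> P y -> P (x / y)).

Definition subfield_pred : {pred L} := fun x => boolp.asbool (P x).

Fact subfield_pred_closed : divring_closed subfield_pred.
Proof.
split=> [|x y|x y]; rewrite !unfold_in; first exact/boolp.asboolP.
  by move=> /boolp.asboolP Px /boolp.asboolP Py; apply/boolp.asboolP/PB.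
by move=> /boolp.asboolP Px /boolp.asboolP Py; apply/boolp.asboolP/Pdiv.
Qed.
#[local] HB.instance Definition _ :=
  GRing.isDivringClosed.Build L subfield_pred subfield_pred_closed.

Record subfield_type := SubfieldType
  { subfield_val : L; _ : subfield_val \in subfield_pred }.
#[local] HB.instance Definition _ := [isSub for subfield_val].
#[local] HB.instance Definition _ := [Choice of subfield_type by <:].
#[local] HB.instance Definition _ := [SubChoice_isSubComUnitRing of subfield_type by <:].
#[local] HB.instance Definition _ :=
  [SubComUnitRing_isSubIntegralDomain of subfield_type by <:].
#[local] HB.instance Definition _ :=
  [SubIntegralDomain_isSubField of subfield_type by <:].

(** Packages the subset as an abstract field with an embedding, so that the theory of irreducible
    polynomials and field extensions applies to it. *)
Lemma subfield_embedding : exists (K : fieldType) (iota : {rmorphism K -> L}),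
  forall x, P x <-> exists a, x = iota a.
Proof.
exists (subfield_type : fieldType), (\val : {rmorphism subfield_type -> L}) => x.
split=> [/boolp.asboolP Px|[a ->]]; last exact/boolp.asboolP/(valP a).
by exists (SubfieldType Px).
Qed.

End SubfieldType.

Lemma map_poly_lift (K L : nzRingType) (iota : {rmorphism K -> L}) (f : {poly L}) :
  (forall i, exists a, f`_i = iota a) -> exists p, f = map_poly iota p.
Proof.
move=> fK; have fK' i : exists a, f`_i == iota a by have [a ->] := fK i; exists a.
exists (\poly_(i < size f) xchoose (fK' i)); apply/polyP=> i.
rewrite coef_map coef_poly; case: ltnP => [_|le_i]; first exact/eqP/(xchooseP (fK' i)).
by rewrite nth_default //; apply/esym/rmorph0.
Qed.

Section MinimalPolynomial.
Variables (K L : fieldType) (iota : {rmorphism K -> L}) (P : L -> Prop).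
Hypothesis PE : forall x, P x <-> exists a, x = iota a.

Lemma minpoly_lift z f : is_minpoly P z f ->
  exists p, [/\ f = map_poly iota p, irreducible_poly p & p \is monic].
Proof.
case=> fmonic fP fz fmin; have [|p fE] := map_poly_lift (iota := iota) (f := f).
  by move=> i; apply/PE.
exists p; rewrite fE in fmonic fz fmin; split=> //; last by rewrite -(map_monic iota).
have p0 : p != 0 by rewrite -(map_poly_eq0 iota) monic_neq0.
apply/(subfx_irreducibleP fz p0) => q qz q0.
rewrite -(size_map_poly iota p) -(size_map_poly iota q); apply: fmin => //.
  by rewrite map_poly_eq0.
by move=> i; apply/PE; exists q`_i; rewrite coef_map.
Qed.

Lemma minpoly_size z f f' : is_minpoly P z f -> is_minpoly P z f' -> size f = size f'.
Proof.
case=> fm fP fz fmin [fm' fP' fz' fmin']; apply/eqP.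
by rewrite eqn_leq fmin ?fmin' ?monic_neq0.
Qed.

(** The lifts are irreducible with the common root [z'], so they divide each other. *)
Lemma minpoly_common_root z z' f f' : is_minpoly P z f -> is_minpoly P z' f' ->
  root f z' -> size f = size f'.
Proof.
move=> fP fP' fz'; case: (fP') => _ _ fz'' _.
have [p [E pI _]] := minpoly_lift fP; have [p' [E' pI' _]] := minpoly_lift fP'.
rewrite E E' in fz' fz'' *; rewrite !size_map_poly; apply: eqp_size.
by rewrite /eqp (irreducible_dvdp_root pI fz' fz'') (irreducible_dvdp_root pI' fz'' fz').
Qed.

Lemma minpoly_linear z f : is_minpoly P z f -> size f = 2 -> P z.
Proof.
move=> fP sf; case: (fP) => fm fK fz _; apply/PE.
have [a aE] := (PE _).1 (fK 0); exists (- a).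
move: fz fm; rewrite /root monicE lead_coefE horner_coef sf !big_ord_recl big_ord0 /=.
rewrite expr0 expr1 mulr1 addr0 aE => + /eqP f1; rewrite f1 mul1r addrC addr_eq0.
by rewrite rmorphN => /eqP.
Qed.

(** The derivative is nonzero in characteristic zero and has smaller size, so minimality keeps it
    from vanishing at [z]. *)
Lemma minpoly_simple z f : (forall m, (0 < m)%N -> m%:R != 0 :> K) ->
  is_minpoly P z f -> f^`().[z] != 0.
Proof.
move=> charK fP; case: (fP) => fm _ fz fmin.
have [p [E pI pm]] := minpoly_lift fP; rewrite E in fz fmin *.
have sp : (1 < size p)%N by case: pI.
have p'0 : p^`() != 0.
  apply/eqP=> /polyP/(_ (size p).-2); rewrite coef0 coef_deriv.
  rewrite prednK -?subn1 ?subn_gt0 // subn1 -lead_coefE (monicP pm) => /eqP.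
  by apply/negP/charK; rewrite -subn1 subn_gt0.
apply: contraTN (lt_size_deriv (monic_neq0 pm)) => /eqP pz.
rewrite -leqNgt -(size_map_poly iota p) -(size_map_poly iota p^`()).
apply: fmin; rewrite ?map_poly_eq0 //.
  by move=> i; apply/PE; exists p^`()`_i; rewrite coef_map.
by apply/eqP; rewrite -deriv_map.
Qed.

End MinimalPolynomial.

(** * Keller maps *)

Section KellerMap.
Variables (C : numClosedFieldType).
Local Notation M := {mpoly C[2]}.
Local Notation "''d1' p" := (mderiv (ord0 : 'I_2) p) (at level 10, p at level 8).
Local Notation "''d2' p" := (mderiv (ord_max : 'I_2) p) (at level 10, p at level 8).

Variable F : {rmorphism M -> M}.
Hypothesis FC : forall c, F c%:MP = c%:MP.
Local Notation F1 := (F (x1 C)).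
Local Notation F2 := (F (x2 C)).
Variable jac : C.
Hypothesis jac0 : jac != 0.
Hypothesis jacE : 'd1 F1 * 'd2 F2 - 'd2 F1 * 'd1 F2 = jac%:MP.
Implicit Types (p q a b : M).

Lemma jac_unit : (jac%:MP : M) \is a GRing.unit.
Proof. by apply/mpoly_unitP; exists jac; rewrite ?unitfE. Qed.

Lemma chain_rule i p :
  mderiv i (F p) = F ('d1 p) * mderiv i F1 + F ('d2 p) * mderiv i F2.
Proof.
elim/mpoly_ring_ind: p => [c|j|p q IHp IHq|p q IHp IHq].
- by rewrite FC !mderivC !rmorph0 !mul0r addr0.
- rewrite !mderiv_var; case: (ord2E j) => ->; rewrite rmorph0 rmorph1;
  by rewrite mul0r mul1r ?addr0 ?add0r.
- by rewrite rmorphD !mderivD IHp IHq !rmorphD /=; ring.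
- by rewrite rmorphM !mderivM IHp IHq !rmorphD !rmorphM /=; ring.
Qed.

(** Cramer's rule for the two chain rule equations of [p], whose determinant is [jac]. *)
Lemma cramer1 p : jac%:MP * F ('d1 p) = 'd1 (F p) * 'd2 F2 - 'd2 (F p) * 'd1 F2.
Proof. by rewrite -jacE !(chain_rule _ p); ring. Qed.

Lemma cramer2 p : jac%:MP * F ('d2 p) = 'd2 (F p) * 'd1 F1 - 'd1 (F p) * 'd2 F1.
Proof. by rewrite -jacE !(chain_rule _ p); ring. Qed.

(** By Cramer's rule the derivatives of a kernel element are in the kernel. They have smaller
    degree, so they vanish by induction, and the element is a constant, fixed by [F]. *)
Lemma keller_inj : injective F.
Proof.
apply/raddf_inj=> p; have [n] := ubnP (msize p); elim: n => // n IHn in p *.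
move=> sp Fp0; have [//|p0] := eqVneq p 0.
have d0 i : mderiv i p = 0.
  apply: IHn; first by apply: leq_trans (msize_deriv i p0) _.
  apply: (mulrI jac_unit); rewrite mulr0.
  by case: (ord2E i) => ->; rewrite ?cramer1 ?cramer2 Fp0 !mderiv0 !mul0r subrr.
by move: Fp0; rewrite (mderiv0_const d0) => /(etrans (esym (FC _))).
Qed.

Lemma keller_unit p : F p \is a GRing.unit -> p \is a GRing.unit.
Proof.
case/mpoly_unitP=> c cU; rewrite -FC => /keller_inj ->.
by apply/mpoly_unitP; exists c.
Qed.

Lemma keller_peval u (r : {poly C}) : F (peval u r) = peval (F u) r.
Proof.
elim/poly_ind: r => [|r c IHr]; first by rewrite !rmorph0.
by rewrite !rmorphD !rmorphM /= IHr !pevalX !pevalC FC.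
Qed.

(* The curve [q = 0] cannot be contracted by the map to a point [(c, d)]. *)
Lemma keller_no_contraction q c d : prime_elt q ->
  divides q (F1 - c%:MP) -> divides q (F2 - d%:MP) -> False.
Proof.
move=> qP [m E1] [n E2]; apply: (prime_ndiv_unit qP jac_unit).
have D1 i : mderiv i F1 = mderiv i m * q + m * mderiv i q.
  by rewrite -mderivM -E1 mderivB mderivC subr0.
have D2 i : mderiv i F2 = mderiv i n * q + n * mderiv i q.
  by rewrite -mderivM -E2 mderivB mderivC subr0.
(* The quotient by [q] of the Jacobian of [m * q] and [n * q], in which the terms without a factor
   [q] cancel. *)
exists (('d1 m * 'd2 n - 'd2 m * 'd1 n) * q
        + 'd1 m * n * 'd2 q + m * 'd1 q * 'd2 n
        - 'd2 m * n * 'd1 q - m * 'd2 q * 'd1 n).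
by rewrite -jacE !D1 !D2; ring.
Qed.

(** Eliminating [x2] between [p] and [b] shows that [q] divides some [F1 - c]. Modulo [q] the images
    of [p] and [b] are then polynomials in [F2]; a nonzero one would make [q] divide some [F2 - d],
    which is excluded. If both are zero, [x1 - c] divides [p] and [b]. *)
Lemma keller_coprime p b q : prime_elt p -> ~ divides p b -> prime_elt q ->
  divides q (F p) -> divides q (F b) -> False.
Proof.
move=> pP pNb qP qFp qFb.
have [r r0 [u [v E]]] := mpoly_elimination pP pNb.
have [c qc] : exists c, divides q (F1 - c%:MP).
  apply: (prime_divides_peval qP r0).
  rewrite -keller_peval E rmorphD !rmorphM /=.
  by apply: dividesD; apply: divides_mull.
have spec_div a : divides q (F a) -> divides q (peval F2 (specialize_x1 c a)).
  move=> qFa; have := divides_rmorph F (specialize_x1_congr c a).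
  rewrite !rmorphB /= FC keller_peval => /(divides_trans qc) H.
  by rewrite -[peval _ _](subKr (F a)); apply: dividesB.
have done_by a : divides q (F a) -> specialize_x1 c a != 0 -> False.
  move=> /spec_div qa a0.
  have [d qd] := prime_divides_peval qP a0 qa.
  exact: keller_no_contraction qP qc qd.
have [p0|] := eqVneq (specialize_x1 c p) 0; last exact: done_by.
have [b0|] := eqVneq (specialize_x1 c b) 0; last exact: done_by.
have := specialize_x1_congr c p; rewrite p0 rmorph0 subr0 => -[w pE].
have lb : divides (x1 C - c%:MP) b.
  by have := specialize_x1_congr c b; rewrite b0 rmorph0 subr0.
(* Either [p] is associated to [x1 - c], which divides [b], or the multiple [F1 - c] of [q] is a
   unit. *)
have [wU|lU] : w \is a GRing.unit \/ x1 C - c%:MP \is a GRing.unit.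
- by have [_ _] := prime_irreducible pP; apply.
- apply: pNb; apply: divides_trans lb; exists w^-1.
  by rewrite pE mulKr.
- move/(rmorph_unit F): lU; rewrite rmorphB /= FC => lU.
  exact: prime_ndiv_unit qP lU qc.
Qed.

(** [q] divides the derivatives of [F p], hence by Cramer's rule the images of those of [p]. By
    [keller_coprime], [p] divides its own derivatives; these vanish for degree reasons, and [p]
    would be constant. *)
Lemma keller_squarefree p q s : prime_elt p -> prime_elt q ->
  F p = q * q * s -> False.
Proof.
move=> pP qP E; have [p0 pU _] := pP.
have qd i : divides q (mderiv i (F p)).
  rewrite E !mderivM; exists (mderiv i q * s + mderiv i q * s + q * mderiv i s).
  by ring.
have qF i : divides q (F (mderiv i p)).
  apply: (prime_dividesZ qP jac_unit).
  by case: (ord2E i) => ->; rewrite ?cramer1 ?cramer2; apply: dividesB; apply: divides_mulr.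
have d0 i : mderiv i p = 0.
  apply/eqP/negP=> /negP d0.
  apply: (keller_coprime pP _ qP _ (qF i)); last by exists (q * s); rewrite E; ring.
  case=> u dE; have := msize_deriv i p0; rewrite ltnNge dE msizeM //; last first.
    by apply: contraNneq d0 => u0; rewrite dE u0 mul0r.
  have : (0 < msize u)%N.
    by rewrite lt0n msize_poly_eq0; apply: contraNneq d0 => u0; rewrite dE u0 mul0r.
  by case: (msize u) => // k _; rewrite addSn leq_addl.
have pE := mderiv0_const d0; case/negP: pU.
apply/mpoly_unitP; exists p@_0 => //; rewrite unitfE.
by apply: contraNneq p0 => c0; rewrite pE c0 mpolyC0.
Qed.

(** Supplies a prime of multiplicity one in [F p], through which the multiplicity of [p] in [a] can
    be read off from [F a]. *)
Lemma keller_prime_factor p : prime_elt p ->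
  exists q s, [/\ prime_elt q, F p = q * s & ~ divides q s].
Proof.
move=> pP; have [p0 pU _] := pP.
have [||q qP [s E]] := @prime_divisor C (F p).
- by rewrite -(rmorph0 F) (inj_eq keller_inj).
- by apply: contra pU; apply: keller_unit.
exists q, s; rewrite E mulrC; split=> // -[t st].
by apply: (keller_squarefree (s := t) pP qP); rewrite E st; ring.
Qed.

(** Descent on the degree of [a]. If [p] has multiplicity [e] in [a], so has a simple prime factor
    [q] of [F p] in [F a]; comparing multiplicities of [q] gives that [m] divides [e], and [p ^+ e]
    is split off. *)
Lemma keller_root_poly m u v a : (0 < m)%N -> u != 0 -> v != 0 ->
  u ^+ m = F a * v ^+ m -> exists c b, a = c%:MP * b ^+ m.
Proof.
move=> m0 u0; have [n] := ubnP (msize a); elim: n => // n IHn in a v *.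
move=> sa v0 E; have a0 : a != 0.
  by apply: contraNneq u0 => a0; move/eqP: E; rewrite a0 rmorph0 mul0r expf_eq0 m0.
have [/mpoly_unitP[c _ ->]|aU] := boolP (a \is a GRing.unit).
  by exists c, 1; rewrite expr1n mulr1.
have [p pP pa] := prime_divisor a0 aU; have [p0 pU _] := pP.
have [e [b [aE pNb]]] := prime_factorization pU a0.
have [q [s [qP Fp qNs]]] := keller_prime_factor pP; have [_ qU qM] := qP.
have [i [u' [uE qNu]]] := prime_factorization qU u0.
have [j [v' [vE qNv]]] := prime_factorization qU v0.
have qNX w k : ~ divides q w -> ~ divides q (w ^+ k) by move=> qNw /(prime_dividesX qP).
have eE : (i * m)%N = (e + j * m)%N.
  apply: (@multiplicity_unique C q (u' ^+ m) (s ^+ e * F b * v' ^+ m)) => //.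
  - exact: qNX.
  - case/qM => [/qM[]|]; [exact: qNX | | exact: qNX].
    apply: (keller_coprime pP pNb qP); rewrite Fp; apply: divides_mulr.
    exact: divides_refl.
  - rewrite exprM -exprMn -uE E aE rmorphM rmorphXn /= Fp vE !exprMn -exprM exprD.
    by ring.
have [t tE] : exists t, e = (t * m)%N.
  by exists (i - j)%N; rewrite mulnBl eE addnK.
have e0 : (0 < e)%N.
  by rewrite lt0n; apply/eqP=> e0; apply: pNb; move: pa; rewrite aE e0 mul1r.
(* [F p ^+ t] joins [v], so the equation keeps its form with [b] in place of [a]. *)
have [|||c [d bE]] := IHn b (F p ^+ t * v).
- by rewrite -ltnS; apply: leq_trans sa; rewrite ltnS (msize_factor a0 _ aE) // unitrX_pos.
- rewrite mulf_neq0 // expf_neq0 // -(rmorph0 F) (inj_eq keller_inj) //.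
- by rewrite E aE tE rmorphM rmorphXn /= exprMn exprM; ring.
by exists c, (p ^+ t * d); rewrite aE bE tE exprMn exprM; ring.
Qed.

(** * The ring [C[F1, F2]] and its fraction field *)

Definition keller_image p := exists q, p = F q.

Lemma keller_image1 : keller_image 1. Proof. by exists 1; rewrite rmorph1. Qed.

Lemma keller_imageB a b : keller_image a -> keller_image b -> keller_image (a - b).
Proof. by case=> u -> [v ->]; exists (u - v); rewrite rmorphB. Qed.

Lemma keller_imageM a b : keller_image a -> keller_image b -> keller_image (a * b).
Proof. by case=> u -> [v ->]; exists (u * v); rewrite rmorphM. Qed.

Local Notation K := (frac_of keller_image).

Definition const_frac : {rmorphism C -> {fraction M}} := @FracField.tofrac M \o @mpolyC 2 C.

(** The constants contain a primitive [m]-th root of unity, whose powers exhaust the [m]-th roots of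
    unity of a field. *)
Lemma frac_root1_const m (z : {fraction M}) : (0 < m)%N -> z ^+ m = 1 ->
  exists c : C, z = (c%:MP)%:F.
Proof.
move=> m0 z1; have [w wP] := closed_prim_root C m0.
have /prim_rootP/(_ _ z1)[i ->] : m.-primitive_root (const_frac w).
  by rewrite fmorph_primitive_root.
by exists (w ^+ i); rewrite -rmorphXn.
Qed.

(** After clearing denominators, [keller_root_poly] produces an element of [K] with the same [m]-th
    power as [w]; the two differ by a root of unity, which is a constant. *)
Lemma keller_root_closed m w : (0 < m)%N -> K (w ^+ m) -> K w.
Proof.
move=> m0 [_ [_ [[a ->] [b ->] b0 wE]]].
have [u [v [v0 Ew]]] := fraction_ratio w.
have [u0|u0] := eqVneq u 0.
  exists 0, 1; rewrite oner_neq0 Ew u0 rmorph0 !mul0r; split=> //.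
    by exists 0; rewrite rmorph0.
  by exists 1; rewrite rmorph1.
have E : u ^+ m * F b = F a * v ^+ m.
  apply/eqP; rewrite -tofrac_eq !rmorphM !rmorphXn /=.
  by rewrite -eqr_div ?expf_neq0 ?tofrac_eq0 // -expr_div_n -Ew wE.
(* Multiplying by [F b ^+ m.-1] makes the left-hand side an [m]-th power. *)
have Eb : (u * F b) ^+ m = F (a * b ^+ m.-1) * v ^+ m.
  rewrite exprMn -{2}(prednK m0) exprS mulrA E rmorphM rmorphXn /=; ring.
have [c [d aE]] := keller_root_poly m0 (mulf_neq0 u0 b0) v0 Eb.
have [r rE] : exists r, r ^+ m = c.
  have [|r] := @closed_rootP C ('X^m - c%:P) _.
    by rewrite size_XnsubC // -(prednK m0).
  by rewrite /root !hornerE subr_eq0 => /eqP; exists r.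
have Er : (u * F b) ^+ m = (F (r%:MP * d) * v) ^+ m.
  by rewrite Eb aE -rE exprMn !rmorphM !rmorphXn /= exprMn !FC.
have n0 : F (r%:MP * d) * v != 0.
  have := expf_neq0 m (mulf_neq0 u0 b0); rewrite Er; apply: contraNneq => ->.
  by rewrite expr0n gtn_eqF.
set g := F (_ * d) in Er n0; move: n0; rewrite mulf_eq0 negb_or => /andP[g0 _].
have [|c' c'E] := @frac_root1_const m ((u * F b)%:F / (g * v)%:F) m0.
  by rewrite expr_div_n -!rmorphXn /= Er divff // tofrac_eq0 expf_neq0 ?mulf_neq0.
exists (F (c'%:MP * (r%:MP * d))), (F b); split=> //; [by eexists | by eexists |].
rewrite rmorphM FC -/g (rmorphM (@FracField.tofrac M)) /= -c'E Ew !rmorphM /=.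
have cancel_bg (L : fieldType) (x y z t : L) : y != 0 -> z != 0 -> t != 0 ->
    x / y = x * z / (t * y) * t / z by move=> y0 z0 t0; field; rewrite y0 z0 t0.
by rewrite -cancel_bg // tofrac_eq0.
Qed.

(** Descent on the degree of [b]: a prime [q] of [b] that divides [a] cancels. Otherwise a prime
    factor of [F q] divides both [F q] and [F a = p * F b], against [keller_coprime]. *)
Lemma keller_frac_image p : K p%:F -> keller_image p.
Proof.
case=> _ [_ [[a ->] [b ->] b0 pE]].
have {pE} : p * F b = F a.
  apply/eqP; rewrite -tofrac_eq rmorphM /= pE divfK ?tofrac_eq0 //.
have {b0} : b != 0 by apply: contraNneq b0 => ->; rewrite rmorph0.
have [n] := ubnP (msize b); elim: n => // n IHn in a b *.
move=> sb b0 E; have [/mpoly_unitP[c cU bE]|bU] := boolP (b \is a GRing.unit).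
  exists (c^-1%:MP * a); rewrite rmorphM -E FC bE FC mulrCA -mpolyCM mulVr //.
  by rewrite mpolyC1 mulr1.
have [q qP [b' bE]] := prime_divisor b0 bU; have [q0 qU _] := qP.
have [[a' aE]|qNa] := boolp.pselect (divides q a).
  apply: (IHn a' b').
  - by rewrite -ltnS; apply: leq_trans sb; rewrite ltnS (msize_factor b0 qU) // mulrC.
  - by apply: contraNneq b0 => b'0; rewrite bE b'0 mul0r.
  - apply: (mulIf (x := F q)); first by rewrite -(rmorph0 F) (inj_eq keller_inj).
    by rewrite -mulrA -!rmorphM /= -bE -aE.
have [s [t [sP Fq _]]] := keller_prime_factor qP.
case: (@keller_coprime q a s) => //; first by rewrite Fq; apply/divides_mulr/divides_refl.
by rewrite -E bE rmorphM /= Fq; do 2 apply: divides_mull; apply/divides_mulr/divides_refl.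
Qed.

(** * Derivations of the field [K(x1)] *)

Section IntermediateField.
Variable g : {poly M}.
Local Notation ev h := (map_poly F h).[x1 C].
Hypothesis g_root : ev g = 0.
Hypothesis g_simple : ev g^`() != 0.

(** The ring [A[x1]], with coefficients recorded by their preimages under [F]. *)
Definition adjoin_x1 p := exists h : {poly M}, p = ev h.

Lemma adjoin_x1_1 : adjoin_x1 1.
Proof. by exists 1; rewrite rmorph1 hornerC. Qed.

Lemma adjoin_x1B a b : adjoin_x1 a -> adjoin_x1 b -> adjoin_x1 (a - b).
Proof. by case=> u -> [v ->]; exists (u - v); rewrite rmorphB hornerD hornerN. Qed.

Lemma adjoin_x1D a b : adjoin_x1 a -> adjoin_x1 b -> adjoin_x1 (a + b).
Proof. by case=> u -> [v ->]; exists (u + v); rewrite rmorphD hornerD. Qed.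

Lemma adjoin_x1M a b : adjoin_x1 a -> adjoin_x1 b -> adjoin_x1 (a * b).
Proof. by case=> u -> [v ->]; exists (u * v); rewrite rmorphM hornerM. Qed.

Local Notation E := (frac_of adjoin_x1).
Let EB := @frac_ofB _ _ adjoin_x1B adjoin_x1M.
Let ED := @frac_ofD _ _ adjoin_x1_1 adjoin_x1B adjoin_x1M.
Let EM := @frac_ofM _ _ adjoin_x1_1 adjoin_x1B adjoin_x1M.
Let Ediv := @frac_of_div _ _ adjoin_x1_1 adjoin_x1B adjoin_x1M.
Let Etofrac := @frac_of_tofrac _ _ adjoin_x1_1.

Lemma adjoin_x1_F p : adjoin_x1 (F p).
Proof. by exists p%:P; rewrite map_polyC hornerC. Qed.

Lemma adjoin_x1_peval r : adjoin_x1 (peval (x1 C) r).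
Proof.
exists (map_poly (@mpolyC 2 C) r); rewrite pevalE -map_poly_comp.
by congr _.[_]; apply: eq_map_poly => c /=; rewrite FC.
Qed.

Section LiftedDerivation.
Variables (D d : M -> M) (k : M).
Hypothesis Dadd : forall u v, D (u + v) = D u + D v.
Hypothesis Dmul : forall u v, D (u * v) = D u * v + u * D v.
Hypothesis DF : forall p, D (F p) = k * F (d p).
Hypothesis Ek : adjoin_x1 k.

(** The term [a] collects the differentiated coefficients; it stays in [A[x1]] because [D] maps
    [F p] to [k * F (d p)]. *)
Lemma lifted_derivation_ev h :
  exists2 a, adjoin_x1 a & D (ev h) = a + ev h^`() * D (x1 C).
Proof.
elim/poly_ind: h => [|h c [a [h' ->] IHh]].
  exists (k * F (d 0)); first by apply: adjoin_x1M => //; apply: adjoin_x1_F.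
  by rewrite deriv0 rmorph0 horner0 mul0r addr0 -{1}(rmorph0 F) DF.
exists (ev (h' * 'X) + k * F (d c)).
  by apply: adjoin_x1D; [exists (h' * 'X) | apply/adjoin_x1M/adjoin_x1_F].
rewrite derivMXaddC !rmorphD !rmorphM /= map_polyX map_polyC !hornerE Dadd DF Dmul IHh.
by ring.
Qed.

(** Differentiating [g(x1) = 0] gives [D x1 = - a / g'(x1)], where [g'(x1)] is nonzero because the
    root is simple. *)
Lemma lifted_derivation_x1 : E (D (x1 C))%:F.
Proof.
have [a Ba] := lifted_derivation_ev g.
have D0 : D 0 = 0 by apply: (addrI (D 0)); rewrite -Dadd !addr0.
rewrite g_root D0 => /esym/eqP; rewrite addrC addr_eq0 => /eqP Da.
have -> : (D (x1 C))%:F = (0 - a)%:F / (ev g^`())%:F :> {fraction M}.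
  by apply: (canRL (mulfK _)); rewrite ?tofrac_eq0 // -rmorphM mulrC /= Da sub0r.
apply: Ediv; apply: Etofrac; last by eexists.
by apply: adjoin_x1B => //; exists 0; rewrite rmorph0 horner0.
Qed.

Lemma lifted_derivation_stable u : E u%:F -> E (D u)%:F.
Proof.
move=> Eu; case: (Eu) => _ [_ [[h ->] [l ->] l0 uE]].
have EDev f : E (D (ev f))%:F.
  have [a Ba ->] := lifted_derivation_ev f; rewrite rmorphD rmorphM /=.
  apply: ED; first exact: Etofrac.
  by apply: EM; [apply: Etofrac; eexists | apply: lifted_derivation_x1].
have {uE} ulE : u * ev l = ev h.
  by apply/eqP; rewrite -tofrac_eq rmorphM /= uE divfK ?tofrac_eq0.
have -> : (D u)%:F = ((D (ev h))%:F - u%:F * (D (ev l))%:F) / (ev l)%:F.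
  apply: (canRL (mulfK _)); first by rewrite tofrac_eq0.
  by rewrite -ulE Dmul rmorphD !rmorphM /= addrK.
by apply: Ediv; [apply: EB; [|apply: EM] | apply: Etofrac; eexists].
Qed.

End LiftedDerivation.

Lemma adjoin_x1_d2 u : E u%:F -> E ('d2 u)%:F.
Proof.
move=> Eu.
(* [D1] and [D2] are [jac] times d/dF1 and d/dF2; on [x1] they take the values ['d2 F2] and
   [- 'd2 F1]. *)
pose D1 u := 'd1 u * 'd2 F2 - 'd2 u * 'd1 F2.
pose D2 u := 'd2 u * 'd1 F1 - 'd1 u * 'd2 F1.
have D1F p : D1 (F p) = jac%:MP * F ('d1 p) by rewrite cramer1.
have D2F p : D2 (F p) = jac%:MP * F ('d2 p) by rewrite cramer2.
have D1D v w : D1 (v + w) = D1 v + D1 w by rewrite /D1 !mderivD; ring.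
have D2D v w : D2 (v + w) = D2 v + D2 w by rewrite /D2 !mderivD; ring.
have D1M v w : D1 (v * w) = D1 v * w + v * D1 w by rewrite /D1 !mderivM; ring.
have D2M v w : D2 (v * w) = D2 v * w + v * D2 w by rewrite /D2 !mderivM; ring.
have Ejac : adjoin_x1 jac%:MP by rewrite -FC; apply: adjoin_x1_F.
have ED1 := lifted_derivation_stable D1D D1M D1F Ejac Eu.
have ED2 := lifted_derivation_stable D2D D2M D2F Ejac Eu.
have EF2 : E ('d2 F2)%:F.
  have := lifted_derivation_x1 D1D D1M D1F Ejac.
  by rewrite /D1 /x1 !mderiv_var /= mul1r mul0r subr0.
have EF1 : E (- 'd2 F1)%:F.
  have := lifted_derivation_x1 D2D D2M D2F Ejac.
  by rewrite /D2 /x1 !mderiv_var /= mul1r mul0r sub0r.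
have -> : ('d2 u)%:F = (('d2 F2)%:F * (D2 u)%:F - (- 'd2 F1)%:F * (D1 u)%:F)
                     / (jac%:MP)%:F :> {fraction M}.
  apply: (canRL (mulfK _)); first by rewrite tofrac_eq0 mpolyC_eq0.
  by rewrite -!rmorphM -rmorphB; congr _%:F; rewrite -jacE /D1 /D2; ring.
apply: Ediv; last exact: Etofrac.
by apply: EB; apply: EM.
Qed.

Lemma adjoin_x1_x2 : E (x2 C)%:F.
Proof.
(* Such a [u] is [r1(x1) * x2 + r0(x1)] with nonzero [r1], and can be solved for [x2] in [K(x1)]. *)
suff [u Eu [u1 u2]] : exists2 u, E u%:F & 'd2 u != 0 /\ 'd2 ('d2 u) = 0.
  have [r1 r1E] := mderiv2_eq0 u2.
  have [r0 r0E] : exists r, u - 'd2 u * x2 C = peval (x1 C) r.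
    apply: mderiv2_eq0; rewrite mderivB mderivM u2 /x2 mderiv_var eqxx.
    by rewrite mul0r add0r mulr1 subrr.
  have -> : (x2 C)%:F = (u%:F - (u - 'd2 u * x2 C)%:F) / ('d2 u)%:F :> {fraction M}.
    apply: (canRL (mulfK _)); first by rewrite tofrac_eq0.
    by rewrite -rmorphM -rmorphB /=; congr _%:F; ring.
  apply: Ediv; last by rewrite r1E; apply/Etofrac/adjoin_x1_peval.
  by apply: EB; rewrite // r0E; apply/Etofrac/adjoin_x1_peval.
have [u Eu u0] : exists2 u, E u%:F & 'd2 u != 0.
  have [F1_0|] := eqVneq ('d2 F1) 0; last by exists F1 => //; apply/Etofrac/adjoin_x1_F.
  exists F2; first exact/Etofrac/adjoin_x1_F.
  apply/eqP=> F2_0; move/eqP: jacE; rewrite F1_0 F2_0 mul0r mulr0 subrr eq_sym.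
  by rewrite mpolyC_eq0 (negPf jac0).
(* Replacing [u] by ['d2 u] stays in [K(x1)] and lowers the degree, so the process stops at degree
   one in [x2]. *)
have [n] := ubnP (msize u); elim: n => // n IHn in u Eu u0 *.
move=> su; have [u2|u2] := eqVneq ('d2 ('d2 u)) 0; first by exists u.
apply: (IHn ('d2 u)) => //; first exact: adjoin_x1_d2.
apply: leq_trans (msize_deriv _ _) _; last by rewrite -ltnS.
by apply: contraNneq u0 => ->; rewrite mderiv0.
Qed.

End IntermediateField.

Local Notation tofrac := (@FracField.tofrac M).

Lemma keller_image_frac p : keller_image p -> K p%:F.
Proof. exact: frac_of_tofrac keller_image1 _. Qed.

Lemma x1_neq_x2 : (x2 C)%:F != (x1 C)%:F :> {fraction M}.
Proof.
rewrite tofrac_eq; apply/eqP=> /(congr1 (mderiv ord_max)).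
by rewrite !mderiv_var => /eqP; rewrite oner_eq0.
Qed.

Lemma keller_subfield : exists (Kt : fieldType) (iota : {rmorphism Kt -> {fraction M}}),
  forall z, K z <-> exists c : Kt, z = iota c.
Proof.
apply: subfield_embedding.
- by rewrite -(rmorph1 tofrac); apply/keller_image_frac/keller_image1.
- exact: frac_ofB keller_imageB keller_imageM.
- exact: frac_of_div keller_image1 keller_imageB keller_imageM.
Qed.

(** * Consequences of [x2] being a conjugate of [x1] *)

Section Conjugates.
Variables (f : {poly {fraction M}}) (g : {poly M}) (l : M).
Hypothesis f_min : is_minpoly K (x1 C)%:F f.
Hypothesis f_x2 : root f (x2 C)%:F.
Hypothesis l0 : l != 0.
Hypothesis gE : map_poly tofrac (map_poly F g) = l%:F *: f.

(** For prime degree, [x2] is a second root of [f] in [K(x1)], and [conjugate_radical] gives an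
    element outside [K] with a power in [K], against [keller_root_closed]. *)
Lemma keller_conjugate_degree : ~ prime (size f).-1.
Proof.
move=> fprime.
have [Kt [iota KE]] := keller_subfield.
have charK m : (0 < m)%N -> m%:R != 0 :> Kt.
  move=> m0; rewrite -(fmorph_eq0 iota) rmorph_nat -(rmorph_nat const_frac).
  by rewrite fmorph_eq0 pnatr_eq0 -lt0n.
have primK m : (0 < m)%N -> exists w : Kt, m.-primitive_root w.
  move=> /(closed_prim_root C)[w wP].
  have [|a aE] := (KE (const_frac w)).1.
    by apply: keller_image_frac; exists w%:MP; rewrite FC.
  exists a; rewrite -(fmorph_primitive_root iota) -aE.
  by rewrite fmorph_primitive_root.
have [p [fE pI pm]] := minpoly_lift KE f_min.
have ev_tofrac (h : {poly M}) :
    exists hK : {poly Kt}, (map_poly F h).[x1 C]%:F = (map_poly iota hK).[(x1 C)%:F].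
  have [|hK hKE] := map_poly_lift (iota := iota) (f := map_poly tofrac (map_poly F h)).
    by move=> i; apply/KE; rewrite !coef_map; apply: keller_image_frac; eexists.
  by exists hK; rewrite -hKE horner_map.
case: (f_min) => _ _ fx1 _; rewrite fE in fx1.
have g_root : (map_poly F g).[x1 C] = 0.
  apply/eqP; rewrite -tofrac_eq0 -horner_map /= gE hornerZ fE (rootP fx1).
  by rewrite mulr0.
have g_simple : (map_poly F g^`()).[x1 C] != 0.
  rewrite -tofrac_eq0 -horner_map /= -!deriv_map gE derivZ hornerZ mulf_neq0 //.
    by rewrite tofrac_eq0.
  exact: (minpoly_simple KE charK f_min).
have [_ [_ [[h ->] [k ->] k0 x2E]]] := adjoin_x1_x2 g_root g_simple.
have [hK hKE] := ev_tofrac h; have [kK kKE] := ev_tofrac k.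
(* Since [k(x1)] is nonzero, a Bezout coefficient inverts it modulo the minimal polynomial, and [x2]
   becomes a polynomial in [x1] over [K]. *)
have : coprimep p kK.
  rewrite irreducible_poly_coprime //; apply/negP=> /(dvdpP _ _)[u uE].
  by move: k0; rewrite -tofrac_eq0 kKE uE rmorphM hornerM /= (rootP fx1) mulr0 eqxx.
case/Bezout_eq1_coprimepP=> -[u v] /= uvE.
have vE : (map_poly iota v).[(x1 C)%:F] * (map_poly F k).[x1 C]%:F = 1.
  have := congr1 (fun e : {poly Kt} => (map_poly iota e).[(x1 C)%:F]) uvE.
  rewrite rmorphD !rmorphM /= rmorph1 hornerD !hornerM (rootP fx1) mulr0 add0r.
  by rewrite -kKE hornerC.
have x2K : (x2 C)%:F = (map_poly iota (hK * v)).[(x1 C)%:F] :> {fraction M}.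
  rewrite x2E rmorphM hornerM /= -hKE; congr (_ * _).
  by apply: (mulIf (x := (map_poly F k).[x1 C]%:F)); rewrite ?tofrac_eq0 // vE mulVf ?tofrac_eq0.
have [||w [m [m0 /KE Kwm wN]]] := conjugate_radical pI _ fx1 _ x1_neq_x2 x2K primK.
- by rewrite fE size_map_poly in fprime.
- by rewrite -fE.
by have /KE[a /wN] := keller_root_closed m0 Kwm.
Qed.

Lemma keller_degree1 f2 : is_minpoly K (x2 C)%:F f2 -> size f = 2 ->
  keller_image (x1 C) /\ keller_image (x2 C).
Proof.
move=> f2_min sf.
have [Kt [iota KE]] := keller_subfield.
split; apply: keller_frac_image; first exact: (minpoly_linear KE f_min).
by apply: (minpoly_linear KE f2_min); rewrite -(minpoly_common_root KE f_min f2_min f_x2).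
Qed.

Lemma keller_conjugate_size f2 : is_minpoly K (x2 C)%:F f2 -> size f = size f2.
Proof.
move=> f2_min.
have [Kt [iota KE]] := keller_subfield.
exact: (minpoly_common_root KE f_min f2_min f_x2).
Qed.

End Conjugates.

End KellerMap.

(** * The theorem *)

Lemma det_mx22 (A : comNzRingType) (M : 'M[A]_2) :
  \det M = M ord0 ord0 * M ord_max ord_max - M ord0 ord_max * M ord_max ord0.
Proof.
rewrite (expand_det_row _ ord0) big_ord_recl big_ord1 /cofactor !det_mx11 !mxE /=.
rewrite expr0 expr1 mul1r mulN1r mulrN.
by congr (_ * M _ _ - M _ _ * M _ _); apply: val_inj.
Qed.

Lemma jacobianE (C : idomainType) (F1 F2 : {mpoly C[2]}) :
  jacobian F1 F2 = mderiv ord0 F1 * mderiv ord_max F2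
                   - mderiv ord_max F1 * mderiv ord0 F2.
Proof. by rewrite /jacobian det_mx22 !mxE. Qed.

Lemma exchange_x1 (C : idomainType) : exchange (x1 C) = x2 C.
Proof.
rewrite /exchange /x1 msymX; congr 'X_[_]; apply/mnmP=> i.
by rewrite mnmE !mnm1E tpermV; case: (ord2E i) => ->; rewrite ?tpermL ?tpermR.
Qed.

(** The exchange turns [g(x1)] into [g(x2)] up to sign; the boolean [e] covers the symmetric and the
    skew-symmetric case at once. *)
Lemma exchange_root (C : idomainType) (g : {poly {mpoly C[2]}}) (e : bool) :
  (forall k, exchange g`_k = (-1) ^+ e * g`_k) ->
  g.[x1 C] = 0 -> g.[x2 C] = 0.
Proof.
move=> ge /(congr1 (@exchange C)).
have -> : exchange g.[x1 C] = (-1) ^+ e * g.[x2 C].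
  rewrite /exchange !horner_coef rmorph_sum mulr_sumr; apply: eq_bigr => i _.
  by rewrite rmorphM rmorphXn /= -!/(exchange _) exchange_x1 ge mulrA.
by rewrite /exchange rmorph0 => /eqP; rewrite mulf_eq0 signr_eq0 => /eqP.
Qed.

Section AlgebraEndomorphism.
Variables (C : numClosedFieldType) (F : {lrmorphism {mpoly C[2]} -> {mpoly C[2]}}).

Lemma endomorphism_const c : F c%:MP = c%:MP.
Proof. by rewrite -[c%:MP]mulr1 mul_mpolyC linearZ rmorph1. Qed.

Lemma endomorphism_comp p : F p = p \mPo [tuple F (x1 C); F (x2 C)].
Proof.
apply: (mpoly_rmorph_ext (C := C) (D := {mpoly C[2]}) (f := F) (g := comp_mpoly _)) p => [c|i] /=.
  by rewrite comp_mpolyC; apply: endomorphism_const.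
by rewrite comp_mpolyXU; case: (ord2E i) => ->.
Qed.

(** An equality of predicates, so that it can be rewritten inside [frac_of] and
    [is_ring_minpoly]. *)
Lemma alg_gen_image : alg_gen (F (x1 C)) (F (x2 C)) = keller_image F.
Proof.
apply/boolp.funext=> p; apply/boolp.propext.
by split=> -[q ->]; exists q; [apply/esym|]; apply: endomorphism_comp.
Qed.

(** Substituting preimages of [x1] and [x2] gives a right inverse, which injectivity makes
    two-sided. *)
Lemma endomorphism_bijective : injective F ->
  keller_image F (x1 C) -> keller_image F (x2 C) -> bijective F.
Proof.
move=> Finj [a aE] [b bE]; pose G p := p \mPo [tuple a; b].
have GK : cancel G F.
  apply: (mpoly_rmorph_ext (f := F \o comp_mpoly [tuple a; b]) (g := idfun)) => [c|i] /=.
    by rewrite comp_mpolyC; apply: endomorphism_const.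
  by rewrite comp_mpolyXU; case: (ord2E i) => ->.
by exists G => // p; apply: Finj; rewrite GK.
Qed.

End AlgebraEndomorphism.

Unset Implicit Arguments.

Theorem theorem4p7 (R : realType)
    (F : {lrmorphism {mpoly R[i][2]} -> {mpoly R[i][2]}})
    (F1 F2 : {mpoly R[i][2]})
    (hF1 : F1 = F (x1 R[i])) (hF2 : F2 = F (x2 R[i]))
    (hJac : exists2 c : R[i], c != 0 & jacobian F1 F2 = c%:MP)
    (f1 f2 : {poly {fraction {mpoly R[i][2]}}})
    (hf1 : is_minpoly (frac_of (alg_gen F1 F2)) (x1 R[i])%:F f1)
    (hf2 : is_minpoly (frac_of (alg_gen F1 F2)) (x2 R[i])%:F f2)
    (d1 d2 : nat) (hd1 : d1 = poly_degree f1) (hd2 : d2 = poly_degree f2)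
    (g : {poly {mpoly R[i][2]}})
    (hg : is_ring_minpoly (alg_gen F1 F2) (x1 R[i])%:F g)
    (hsym : (forall k : nat, exchange g`_k = g`_k) \/
            (forall k : nat, exchange g`_k = - g`_k))
    (hgcd : gcdn d1 d2 = 1%N \/ exists2 p : nat, prime p & gcdn d1 d2 = p) :
  bijective F.
Proof.
have [c c0] := hJac; rewrite jacobianE hF1 hF2 => jacE.
rewrite hF1 hF2 alg_gen_image in hf1 hf2 hg.
have FC := endomorphism_const F.
have [gF [f [l [f_min [_ l0 _ _] gE]]]] := hg.
have [g0 gE0] : exists g0, g = map_poly F g0 by apply: (map_poly_lift (iota := F)).
have lF0 : l%:F != 0 :> {fraction {mpoly R[i][2]}} by rewrite tofrac_eq0.
have rootE z : g.[z] = 0 <-> root f z%:F.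
  have -> : root f z%:F = (g.[z] == 0).
    by rewrite -tofrac_eq0 -horner_map /= gE hornerZ mulf_eq0 (negPf lF0).
  by split=> [->|/eqP].
have f_x2 : root f (x2 R[i])%:F.
  apply/rootE; have gx1 : g.[x1 R[i]] = 0 by apply/rootE; case: f_min.
  case: hsym => ge; [apply: (@exchange_root _ g false) | apply: (@exchange_root _ g true)] => //.
    by move=> k; rewrite expr0 mul1r.
  by move=> k; rewrite expr1 mulN1r.
have size_f1 : size f1 = size f := minpoly_size hf1 f_min.
have size_f2 := keller_conjugate_size f_min f_x2 hf2.
rewrite gE0 in gE.
have [|d_neq1] := eqVneq (size f) 2.
  move/(keller_degree1 FC c0 jacE f_min f_x2 hf2) => [Fx1 Fx2].
  exact: (endomorphism_bijective (keller_inj FC c0 jacE)).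
have dE : gcdn d1 d2 = (size f).-1.
  by rewrite hd1 hd2 /poly_degree size_f1 -size_f2 gcdnn.
case: (keller_conjugate_degree FC c0 jacE f_min f_x2 l0 gE).
(* A gcd equal to one would mean size two, already treated, so the degree is prime. *)
rewrite -dE; case: hgcd => [|[p pP ->] //]; rewrite dE.
by case: (size f) d_neq1 => [|[|[|]]].
Qed.
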